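(* For every finite, simple, undirected, connected bipartite graph $G$, we have $cc(G) \le c(G)+2$, where $c(G)$ is the cop number of $G$ (in the ordinary game of Cops and Robbers) and $cc(G)$ is the minimum number of cops that have a winning strategy in the game of Cops and Attacking Robbers on $G$.
   Context: All graphs are finite, connected, simple and undirected. Cops and Robbers: the game is played on a graph $G$ with full information by two players, one controlling a set of cops and the other a single robber. The cops first choose initial vertices (several cops may occupy the same vertex), and then the robber chooses an initial vertex. After that the cops and the robber move alternately, with the cops moving first. On the cops' turn each cop either moves to a neighbouring vertex or stays where she is (any subset of the cops may move). On the robber's turn he either moves to a neighbouring vertex or stays where he is. The cops win if after finitely many rounds some cop occupies the same vertex as the robber (a capture); the robber wins if he can avoid capture indefinitely. The cop number $c(G)$ is the minimum number of cops for which the cops have a winning strategy on $G$. Cops and Attacking Robbers: the rules are the same, except that on his turn the robber may attack a cop: if he moves to a neighbouring vertex on which a cop is present, one cop on that vertex is eliminated (removed from the game). If that vertex contains exactly one cop, she is removed, the robber is not captured by this move, and the game continues with the remaining cops. If it contains two or more cops, only one of them is eliminated, and a remaining cop on that vertex then captures the robber, so the cops win. The robber may not start the game on a vertex occupied by a cop. The parameter $cc(G)$ is the minimum number of cops for which the cops have a winning strategy on $G$ in this game. *)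

(* Defs.v *)
From mathcomp Require Import all_boot.
From mathcomp Require Import boolp.

Set Implicit Arguments.
Unset Strict Implicit.
Unset Printing Implicit Defensive.

Record sgraph := SGraph {
  vertex :> finType;
  edge : rel vertex;
  edge_sym : symmetric edge;
  edge_irrefl : irreflexive edge }.

Definition graph_connected (G : sgraph) : Prop :=
  forall x y : G, connect (@edge G) x y.

Definition bipartite (G : sgraph) : Prop :=
  exists A : {set G}, forall x y : G, edge x y -> (x \in A) != (y \in A).

(** The two games share all their rules but two, so they are defined together;
    the boolean [atk] tells whether the robber may attack cops. *)

Section Game.

Variables (G : sgraph) (atk : bool) (k : nat).

(** [p i = None] means that cop [i] has been eliminated, which never happens
    when [atk] is [false]. *)
Definition cops_pos := {ffun 'I_k -> option G}.

Definition step (x y : G) : bool := (x == y) || edge x y.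

Definition cop_step (a b : option G) : bool :=
  match a, b with
  | Some x, Some y => step x y
  | None, None => true
  | _, _ => false
  end.

Definition cops_step (p q : cops_pos) : bool :=
  [forall i, cop_step (p i) (q i)].

Definition occupied (p : cops_pos) (v : G) : bool :=
  [exists i, p i == Some v].

(** When several cops are on [v], the choice of the eliminated one is
    immaterial: another one stays on [v] and captures the robber. *)
Definition eliminate (q : cops_pos) (v : G) : cops_pos :=
  if [pick i | q i == Some v] is Some i
  then [ffun j => if j == i then None else q j] else q.

(** Cops after a move of the robber from [u] to [v]. *)
Definition after_robber (q : cops_pos) (u v : G) : cops_pos :=
  if atk && edge u v then eliminate q v else q.

(** A strategy consists of initial vertices and of a function giving the cops'
    positions after their next move from the nonempty sequence of all positions
    of the robber so far, in chronological order. Together with the strategy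
    this sequence determines the whole history of the play. *)
Record strategy := Strategy {
  start : {ffun 'I_k -> G};
  reply : seq G -> cops_pos }.

(** [r 0] is the initial vertex of the robber and [r n.+1] his vertex after his
    [n.+1]-st move. In the attacking game a robber with no free vertex to start
    from has no legal play, and the cops win. A play is formally continued
    after a capture; this is harmless since everybody may stay put. *)
Definition robber_legal (s : strategy) (r : nat -> G) : Prop :=
  (atk -> forall i, start s i != r 0) /\ (forall n, step (r n) (r n.+1)).

Definition cops_after (s : strategy) (r : nat -> G) (n : nat) : cops_pos :=
  reply s (mkseq r n.+1).

Definition cops_before (s : strategy) (r : nat -> G) (n : nat) : cops_pos :=
  if n is m.+1 then after_robber (cops_after s r m) (r m) (r n)
  else [ffun i => Some (start s i)].

Definition winning (s : strategy) : Prop :=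
  forall r : nat -> G, robber_legal s r ->
    (forall n, cops_step (cops_before s r n) (cops_after s r n)) /\
    (exists n, occupied (cops_before s r n) (r n)
               \/ occupied (cops_after s r n) (r n)).

Definition cops_win : Prop := exists s : strategy, winning s.

End Game.

Lemma cops_win_ex (G : sgraph) (atk : bool) :
  exists k, `[< cops_win G atk k >].
Proof.
exists #|G|; apply/asboolP.
pose f := [ffun i : 'I_#|G| => enum_val i : G].
exists (Strategy f (fun=> [ffun i => Some (f i)])) => r [r0 _].
have occ v : occupied [ffun i : 'I_#|G| => Some (f i)] v.
  by apply/existsP; exists (enum_rank v); rewrite !ffunE enum_rankK.
case: atk r0 => [/(_ isT (enum_rank (r 0)))|_].
  by rewrite ffunE enum_rankK eqxx.
split; last by exists 0; left; apply: occ.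
by case=> [|n]; apply/forallP => i; rewrite !ffunE /= /step eqxx.
Qed.

Definition cop_number (G : sgraph) : nat :=
  ex_minn (cops_win_ex G false).

Definition attacking_cop_number (G : sgraph) : nat :=
  ex_minn (cops_win_ex G true).

(* Main.v *)
Require Import Defs.
From mathcomp Require Import all_boot.
From mathcomp Require Import boolp.

(** Delete the passes of the robber from the play and let [k] cops shadow a
    winning team of the ordinary game against this shortened play: after each
    move of the cops, the shadow of a cop is within distance one of her and lies
    in the same class of the bipartition as the robber. Two vertices of the same
    class are not adjacent, so that a shadow cannot be attacked, and a shadow
    captures the robber as soon as the cop it follows does. The shadows stay put
    when the robber passes. Two further cops walk together towards the robber:
    attacking them is fatal to him, their distance to him never increases, and
    it decreases whenever he passes, so he passes only finitely often. *)

Set Implicit Arguments.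
Unset Strict Implicit.
Unset Printing Implicit Defensive.

(** * Distances in a connected graph *)

Section Distance.

Variable G : sgraph.

Lemma step_refl (x : G) : step x x.
Proof. by rewrite /step eqxx. Qed.

Fixpoint reach (n : nat) (x y : G) : bool :=
  if n is m.+1 then [exists z, step x z && reach m z y] else x == y.

Lemma reach_step n (x y z : G) : reach n x y -> step y z -> reach n.+1 x z.
Proof.
elim: n x => [|n IHn] x.
  by move=> /eqP-> yz; apply/existsP; exists z; rewrite yz /=.
move=> /existsP[t /andP[xt ty]] yz; apply/existsP; exists t.
by rewrite xt; apply: IHn.
Qed.

Hypothesis connG : graph_connected G.

Lemma reach_ex (x y : G) : exists n, reach n x y.
Proof.
have /connectP[p xp ->] := connG x y; exists (size p).
elim: p x xp => [|z p IHp] x //= /andP[xz zp].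
by apply/existsP; exists z; rewrite /step xz orbT IHp.
Qed.

Definition dist (x y : G) : nat := ex_minn (reach_ex x y).

Lemma dist_le n (x y : G) : reach n x y -> dist x y <= n.
Proof. by rewrite /dist; case: ex_minnP => m _; apply. Qed.

Lemma reach_dist (x y : G) : reach (dist x y) x y.
Proof. by rewrite /dist; case: ex_minnP. Qed.

Lemma dist_approach (x y : G) :
  x != y -> exists2 z, step x z & dist z y < dist x y.
Proof.
move=> neq_xy; have := reach_dist x y.
case: (dist x y) => [|n] /=; first by rewrite (negPf neq_xy).
by case/existsP=> z /andP[xz zy]; exists z; rewrite ?ltnS ?dist_le.
Qed.

Lemma dist_step (x y z : G) :
  step y z -> dist x z <= dist x y + (z != y).
Proof.
have [->|neq_zy] := eqVneq z y; first by rewrite addn0.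
by move=> yz; rewrite addn1; apply/dist_le/(reach_step (reach_dist x y)).
Qed.

(** Lets a shadow change class while the cop it follows stays put. *)
Lemma neighbour_ex (x y : G) : x != y -> exists z, edge x z.
Proof.
have /connectP[[|z p] /=] := connG x y; first by move=> _ ->; rewrite eqxx.
by case/andP=> xz _ _ _; exists z.
Qed.

End Distance.

Lemma split_lshift m n (i : 'I_m) : split (lshift n i) = inl i.
Proof. exact: (unsplitK (inl i)). Qed.

Lemma split_rshift m n (i : 'I_n) : split (rshift m i) = inr i.
Proof. exact: (unsplitK (inr i)). Qed.

(** * Moves of a single cop and the effect of an attack *)

Section CopMove.

Variable G : sgraph.

Implicit Type good : rel G.

(** A capture has priority over the aim [good]; the default [w] keeps the move legal when the aim
    cannot be met. *)
Definition cop_move good (x w : G) : G :=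
  if step w x then x else odflt w [pick z | step w z && good w z].

Lemma cop_move_step good (x w : G) : step w (cop_move good x w).
Proof.
rewrite /cop_move; case: ifP => // _.
by case: pickP => [z /andP[]|_] //=; apply: step_refl.
Qed.

Lemma cop_move_good good (x w z : G) :
  ~~ step w x -> step w z -> good w z -> good w (cop_move good x w).
Proof.
move=> /negPf wx wz gz; rewrite /cop_move wx.
by case: pickP => [t /andP[]|/(_ z)] //; rewrite wz gz.
Qed.

Lemma after_robber_id k (q : cops_pos G k) atk (u v : G) i :
  q i <> Some v -> after_robber atk q u v i = q i.
Proof.
move=> qi; rewrite /after_robber; case: ifP => // _; rewrite /eliminate.
case: pickP => // j /eqP qj; rewrite ffunE; case: eqP => // ij.
by case: qi; rewrite ij.
Qed.

Lemma after_robber_pair k (q : cops_pos G k) atk (u v : G) i j :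
  i != j -> q i = Some v -> q j = Some v -> occupied (after_robber atk q u v) v.
Proof.
move=> neq_ij qi qj; rewrite /after_robber; case: ifP => _; last first.
  by apply/existsP; exists i; rewrite qi.
rewrite /eliminate; case: pickP => [l _|/(_ i)]; last by rewrite qi eqxx.
apply/existsP; have [eq_il|neq_il] := eqVneq i l.
  by exists j; rewrite ffunE -eq_il [j == i]eq_sym (negPf neq_ij) qj.
by exists i; rewrite ffunE (negPf neq_il) qi.
Qed.

End CopMove.

(** * Deleting the passes from a play *)

Section Stutter.

Variables (G : sgraph) (r : nat -> G).
Hypothesis step_r : forall n, step (r n) (r n.+1).

Fixpoint moves (n : nat) : nat :=
  if n is m.+1 then moves m + (r m.+1 != r m) else 0.

Hypothesis moves_unbounded : forall i, exists n, i <= moves n.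

Lemma moves_le m n : m <= n -> moves m <= moves n.
Proof.
elim: n => [|n IHn]; first by rewrite leqn0 => /eqP->.
rewrite leq_eqVlt => /predU1P[->//|/IHn lemn] /=.
exact: leq_trans lemn (leq_addr _ _).
Qed.

(** As [moves] is monotone, it is constant between the two times, so the robber only passes
    there. *)
Lemma moves_eq m n : moves m = moves n -> r m = r n.
Proof.
wlog lemn: m n / m <= n => [hw|].
  by have [/hw//|/ltnW/hw {}hw /esym/hw] := leqP m n.
elim: n lemn => [|n IHn]; first by rewrite leqn0 => /eqP->.
rewrite leq_eqVlt => /predU1P[->//|]; rewrite ltnS => lemn eqm.
move: (moves_le lemn) (IHn lemn); rewrite eqm /=.
case: eqP => [->|_] /=; first by rewrite addn0 => _; apply.
by rewrite addn1 ltnn.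
Qed.

(** Discrete intermediate values: [moves] starts at 0 and grows by at most one. *)
Lemma moves_surj i : exists n, moves n == i.
Proof.
have [n] := moves_unbounded i; elim: n => [|n IHn] /=.
  by rewrite leqn0 => /eqP->; exists 0.
rewrite leq_eqVlt => /predU1P[->|]; first by exists n.+1.
by case: eqP => _ /=; rewrite ?addn0 ?addn1 ?ltnS // => /ltnW.
Qed.

Definition unstutter (i : nat) : G := r (ex_minn (moves_surj i)).

Lemma unstutterE n : unstutter (moves n) = r n.
Proof.
by rewrite /unstutter; case: ex_minnP => m /eqP eqm _; apply: moves_eq.
Qed.

Lemma moves_next i :
  exists n, [/\ moves n = i, moves n.+1 = i.+1 & r n.+1 != r n].
Proof.
have exn := moves_surj i.+1; case: (ex_minnP exn) => -[//|n] eqn minn.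
exists n; move: eqn => /=; case: (boolP (r n.+1 != r n)) => ne /=.
  by rewrite addn1 eqSS => /eqP ->.
by rewrite addn0 => /minn; rewrite ltnn.
Qed.

Lemma unstutter_step i : step (unstutter i) (unstutter i.+1).
Proof. by have [n [<- <- _]] := moves_next i; rewrite !unstutterE. Qed.

End Stutter.

(** * The strategy with two extra cops *)

Section Strategy.

Variables (G : sgraph) (A : {set G}) (k : nat) (s : strategy G k) (y0 : G).
Hypothesis connG : graph_connected G.
Hypothesis edgeA : forall x y : G, edge x y -> (x \in A) != (y \in A).
Hypothesis win_s : winning false s.

Lemma step_class (x y : G) : step x y -> (x \in A) = (y \in A) -> x = y.
Proof. by case/predU1P=> // /edgeA/eqP. Qed.

(** [x] and [z] are the vertices before and after her move of the cop whose
    shadow is on [w]; the robber is on [u]. *)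
Lemma shadow_ex (u w x z : G) :
    step w x -> w = x \/ (w \in A) != (u \in A) -> step x z ->
  exists2 w', step w w' & ((w' \in A) == (u \in A)) && step w' z.
Proof.
move=> wx wu xz.
(* If the cop was in the robber's class, the shadow goes to [x], wherever she moves. *)
have [/eqP xu|neq_xu] := boolP ((x \in A) == (u \in A)).
  have [zu|zu] := boolP ((z \in A) == (u \in A));
    last by exists x; rewrite ?xu ?eqxx.
  by exists x; rewrite ?xu ?eqxx.
(* Otherwise [w] and [x] share a class and are within one step, so they coincide. *)
have {wu} wx0 : w = x.
  case: wu => // wu; apply: step_class => //.
  by move: wu neq_xu; do 3 case: (_ \in A).
subst w; have [zu|zu] := boolP ((z \in A) == (u \in A)).
  by exists z; rewrite ?zu ?step_refl.
(* Both [x] and [z] are in the class opposite to [u], so the cop stays. The shadow takes any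
   neighbour of [x], which exists because [x] differs from [u]. *)
have zx : x = z.
  by apply: step_class => //; move: zu neq_xu; do 3 case: (_ \in A).
have [|y xy] := neighbour_ex connG (x := x) (y := u).
  by apply: contraNneq neq_xu => ->.
exists y; first by rewrite /step xy orbT.
rewrite -zx /step edge_sym xy orbT andbT.
by move: neq_xu (edgeA xy); do 3 case: (_ \in A).
Qed.

(** Since [last x [::]] is [x], the first vertex would be dropped as a pass without the test [h !=
    [::]]. *)
Definition push (h : seq G) (x : G) : seq G :=
  if (h != [::]) && (last x h == x) then h else rcons h x.

Definition compress : seq G -> seq G := foldl push [::].

Lemma compress_rcons (h : seq G) (x : G) :
  compress (rcons h x) = push (compress h) x.
Proof. exact: foldl_rcons. Qed.

Lemma compress_mkseq (r : nat -> G)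
    (unbounded_r : forall i, exists n, i <= moves r n) n :
  compress (mkseq r n.+1) = mkseq (unstutter unbounded_r) (moves r n).+1.
Proof.
elim: n => [|n IHn].
  by rewrite /mkseq /= [unstutter _ _](unstutterE unbounded_r 0).
rewrite mkseqS compress_rcons IHn /push.
rewrite [in last _ _]mkseqS last_rcons unstutterE andTb.
rewrite [moves r n.+1]/= eq_sym; have [eq_r|neq_r] := eqVneq (r n.+1) (r n).
  by rewrite addn0.
rewrite addn1 [RHS]mkseqS; congr rcons.
by rewrite -(unstutterE unbounded_r) /= neq_r addn1.
Qed.

(** Here [h] is the shortened history. Both cops of the pair get the same relation, so from a common
    vertex they choose the same target. *)
Definition aim (h : seq G) (x : G) (i : 'I_(k + 2)) : rel G :=
  match split i with
  | inl j => fun _ z => ((z \in A) == (x \in A)) &&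
                        (if reply s h j is Some v then step z v else false)
  | inr _ => fun w z => dist connG z x < dist connG w x
  end.

(** Positions are carried along to replay eliminations. The default in [last x st.1] makes the
    robber's initial placement no attack. *)
Definition atk_update (st : seq G * cops_pos G (k + 2)) (x : G) :=
  let h := push st.1 x in
  (h, [ffun i => omap (cop_move (aim h x i) x)
                      (after_robber true st.2 (last x st.1) x i)]).

Definition atk_start : {ffun 'I_(k + 2) -> G} :=
  [ffun i => if split i is inl j then start s j else y0].

Definition atk_state : seq G -> seq G * cops_pos G (k + 2) :=
  foldl atk_update ([::], [ffun i => Some (atk_start i)]).

Definition atk_strategy : strategy G (k + 2) :=
  Strategy atk_start (fun h => (atk_state h).2).

Lemma atk_state1 (h : seq G) : (atk_state h).1 = compress h.
Proof.
elim/last_ind: h => [|h x IHh] //.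
by rewrite compress_rcons -IHh /atk_state foldl_rcons.
Qed.

Lemma last_compress (x y : G) (h : seq G) : last y (compress (rcons h x)) = x.
Proof.
rewrite compress_rcons /push; case: ifP => [|_]; last by rewrite last_rcons.
by case: compress => // z t /andP[_ /eqP].
Qed.

(** * Analysis of a play against this strategy *)

Section Play.

Variable r : nat -> G.

Let before := cops_before true atk_strategy r.
Let after := cops_after atk_strategy r.
Let h n := compress (mkseq r n.+1).

Lemma afterE n i :
  after n i = omap (cop_move (aim (h n) (r n) i) (r n)) (before n i).
Proof.
rewrite /after /cops_after /= mkseqS /atk_state foldl_rcons -/(atk_state _).
rewrite ffunE atk_state1 /h mkseqS compress_rcons.
congr omap; rewrite /before; case: n => [|n].
  by rewrite /= /after_robber edge_irrefl.
by rewrite /= {2}mkseqS last_compress.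
Qed.

Lemma atk_legal n : cops_step (before n) (after n).
Proof.
apply/forallP => i; rewrite afterE.
by case: (before n i) => //= w; apply: cop_move_step.
Qed.

Hypothesis legal_r : robber_legal true atk_strategy r.
Hypothesis free_before : forall n, ~ occupied (before n) (r n).
Hypothesis free_after : forall n, ~ occupied (after n) (r n).

Let step_r : forall n, step (r n) (r n.+1) := legal_r.2.

Lemma not_captured_before n i w : before n i = Some w -> w <> r n.
Proof.
move=> bi eq_w; apply: (@free_before n); apply/existsP.
by exists i; rewrite bi eq_w.
Qed.

Lemma not_captured_after n i w : after n i = Some w -> w <> r n.
Proof.
move=> bi eq_w; apply: (@free_after n); apply/existsP.
by exists i; rewrite bi eq_w.
Qed.

(** From within one step [cop_move] would capture. *)
Lemma before_far n i w : before n i = Some w -> ~~ step w (r n).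
Proof.
move=> bi; apply/negP => wr; have := afterE n i.
by rewrite bi /= /cop_move wr => /not_captured_after.
Qed.

Lemma before_survives n i w :
  after n i = Some w -> w <> r n.+1 -> before n.+1 i = Some w.
Proof.
by move=> ai neq_w; rewrite /before /= after_robber_id ai // => -[].
Qed.

Lemma after_aim n i w z :
    before n i = Some w -> step w z -> aim (h n) (r n) i w z ->
  exists2 w', after n i = Some w' & aim (h n) (r n) i w w'.
Proof.
move=> bi wz gz; rewrite afterE bi /=.
exists (cop_move (aim (h n) (r n) i) (r n) w) => //.
exact: cop_move_good (before_far bi) wz gz.
Qed.

(** [n - moves r n] is the number of passes among the first [n] moves. *)
Lemma pair_before n :
  exists2 y, forall i : 'I_2, before n (rshift k i) = Some y
    & dist connG y (r n) + n <= dist connG y0 (r 0) + moves r n.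
Proof.
have advance m y : (forall i : 'I_2, before m (rshift k i) = Some y) ->
    exists2 z, forall i : 'I_2, after m (rshift k i) = Some z
             & dist connG z (r m) < dist connG y (r m).
  move=> bm; have := not_captured_before (bm ord0) => /eqP.
  move=> /(dist_approach connG)[t yt ty].
  pose nearer : rel G := fun w z => dist connG z (r m) < dist connG w (r m).
  have aimE (i : 'I_2) : aim (h m) (r m) (rshift k i) = nearer.
    by rewrite /aim split_rshift.
  exists (cop_move nearer (r m) y); first by move=> i; rewrite afterE bm aimE.
  exact: (cop_move_good (good := nearer) (before_far (bm ord0)) yt ty).
elim: n => [|n [y bn dn]].
  exists y0; last by rewrite addn0.
  by move=> i; rewrite /before /= !ffunE split_rshift.
have [z an dz] := advance n y bn; exists z => [i|].
  apply: before_survives; first exact: an.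
  (* A robber entering [z] eliminates one cop of the pair and is captured by the other. *)
  move=> eq_z; apply: (@free_before n.+1).
  apply: (@after_robber_pair _ _ _ _ _ _ (rshift k ord0) (rshift k ord_max)).
  - by rewrite (inj_eq (@rshift_inj _ _)).
  - by rewrite -eq_z; apply: an.
  - by rewrite -eq_z; apply: an.
(* In each round the pair gains at least one, and the robber regains at most one, only by a genuine
   move. *)
have dzr := dist_step connG z (step_r n).
rewrite addnS /= addnA; apply: leq_trans (leq_add dn (leqnn _)).
rewrite -addSn.
apply: leq_trans (_ : (dist connG z (r n)).+1 + n + (r n.+1 != r n) <= _).
  by rewrite addnAC leq_add2r addSn ltnS.
by rewrite leq_add2r leq_add2r.
Qed.

(** The number of passes never exceeds the initial distance of the pair, which is added to [i] for
    this reason. *)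
Lemma moves_unbounded_pair i : exists n, i <= moves r n.
Proof.
exists (dist connG y0 (r 0) + i).
have [y _] := pair_before (dist connG y0 (r 0) + i).
move=> le_d; rewrite -(leq_add2l (dist connG y0 (r 0))).
exact: leq_trans (leq_addl _ _) le_d.
Qed.

Let r' := unstutter moves_unbounded_pair.

Let legal_r' : robber_legal false s r'.
Proof. by split=> // i; apply: unstutter_step. Qed.

Lemma virtual_alive i j : exists v, cops_after s r' i j = Some v.
Proof.
have [leg _] := win_s legal_r'.
elim: i => [|i [v vi]].
  have /forallP/(_ j) := leg 0; rewrite ffunE /=.
  by case: (cops_after s r' 0 j) => // v; exists v.
have /forallP/(_ j) := leg i.+1; rewrite /= /after_robber /= vi.
by case: (cops_after s r' i.+1 j) => // w; exists w.
Qed.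

Lemma aim_shadow n j v w : cops_after s r' (moves r n) j = Some v ->
  aim (h n) (r n) (lshift 2 j) w =
    fun z => ((z \in A) == (r n \in A)) && step z v.
Proof.
move=> vn; rewrite /aim /h split_lshift (compress_mkseq moves_unbounded_pair).
by rewrite -/r' -/(cops_after s r' _) vn.
Qed.

(** The invariant of the shadows. In its proof [follow] is the cops' turn: a vertex within reach
    that meets the aim suffices. *)
Lemma shadow n j : exists w v,
  [/\ after n (lshift 2 j) = Some w, cops_after s r' (moves r n) j = Some v,
      (w \in A) = (r n \in A) & step w v].
Proof.
have follow m w v z : before m (lshift 2 j) = Some w ->
    cops_after s r' (moves r m) j = Some v ->
    step w z -> ((z \in A) == (r m \in A)) && step z v ->
  exists w v,
    [/\ after m (lshift 2 j) = Some w, cops_after s r' (moves r m) j = Some v,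
        (w \in A) = (r m \in A) & step w v].
  move=> bw vv wz gz; have := after_aim bw wz; rewrite (aim_shadow w vv) gz.
  by case=> // w' aw' /andP[/eqP cw' w'v]; exists w', v.
have [leg _] := win_s legal_r'.
elim: n => [|n [w [v [aw vv wr wv]]]].
  have [v v0] := virtual_alive 0 j.
  have b0 : before 0 (lshift 2 j) = Some (start s j).
    by rewrite /before /= !ffunE split_lshift.
  have sv : step (start s j) v.
    by have /forallP/(_ j) := leg 0; rewrite /= ffunE v0.
  have [||//|z z1 z2] := @shadow_ex (r 0) (start s j) (start s j) v.
  - exact: step_refl.
  - by left.
  exact: follow b0 v0 z1 z2.
have [v' vv'] := virtual_alive (moves r n.+1) j.
(* On a pass the shortened play does not advance, so [v] is unchanged and [w] still meets the
   aim. *)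
have [eq_r|neq_r] := eqVneq (r n.+1) (r n).
  have bw : before n.+1 (lshift 2 j) = Some w.
    by apply: before_survives => //; rewrite eq_r; apply: not_captured_after aw.
  apply: (follow _ _ _ w bw vv' (step_refl _)).
  have -> : v' = v by move: vv'; rewrite /= eq_r eqxx addn0 vv => -[].
  by rewrite eq_r wr eqxx.
(* A genuine move takes the robber out of the class of [w]: he cannot attack there, and [shadow_ex]
   applies with its second alternative. *)
have neq_A : (r n \in A) != (r n.+1 \in A).
  by have /predU1P[e|/edgeA//] := step_r n; rewrite e eqxx in neq_r.
have bw : before n.+1 (lshift 2 j) = Some w.
  by apply: before_survives => // eq_w; rewrite -eq_w wr eqxx in neq_A.
have vstep : step v v'.
  have /forallP/(_ j) := leg (moves r n).+1; rewrite /= /after_robber /= vv.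
  by move: vv'; rewrite /= neq_r addn1 => ->.
have [//||//|z z1 z2] := @shadow_ex (r n.+1) w v v'; first by right; rewrite wr.
exact: follow bw vv' z1 z2.
Qed.

Lemma play_contradiction : False.
Proof.
have [leg [i capt]] := win_s legal_r'.
case: capt => /existsP[j /eqP].
  case: i => [|i].
    (* The attacking robber may not start on a cop. *)
    rewrite /= ffunE -[r' 0]/(r' (moves r 0)) [r' _]unstutterE => -[sj].
    by have := legal_r.1 isT (lshift 2 j); rewrite /= ffunE split_lshift sj eqxx.
  rewrite /= /after_robber /=.
  (* If he runs into a cop of the ordinary game, her shadow is within one step of him, against
     [before_far]. *)
  have [n [ni nsi neq_r]] := moves_next moves_unbounded_pair i.
  rewrite -ni; have [w [v [aw -> wr wv]]] := shadow n j; rewrite ni -nsi.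
  move=> -[]; rewrite -[r' _]/(unstutter _ (moves r n.+1)) unstutterE => eq_v.
  have neq_A : (r n \in A) != (r n.+1 \in A).
    by have /predU1P[e|/edgeA//] := step_r n; rewrite e eqxx in neq_r.
  have bw : before n.+1 (lshift 2 j) = Some w.
    by apply: before_survives => // eq_w; rewrite -eq_w wr eqxx in neq_A.
  by have := before_far bw; rewrite -eq_v wv.
(* If she captures on her turn, her shadow, in his class and within one step, is on his vertex
   too. *)
have /eqP ni := xchooseP (moves_surj moves_unbounded_pair i).
set n := xchoose _ in ni; rewrite -ni.
have [w [v [aw -> wr wv]]] := shadow n j => -[].
rewrite [r' _]unstutterE => eq_v.
by apply: (not_captured_after aw); apply: step_class; rewrite -?eq_v // eq_v.
Qed.

End Play.

Lemma atk_winning : winning true atk_strategy.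
Proof.
move=> r legal_r; split=> [n|]; first exact: atk_legal.
apply: contrapT => nocapt.
apply: (play_contradiction legal_r) => n occ; apply: nocapt.
  by exists n; left.
by exists n; right.
Qed.

End Strategy.

Lemma cops_win_attacking (G : sgraph) (k : nat) (y0 : G) :
    graph_connected G -> bipartite G -> cops_win G false k ->
  cops_win G true (k + 2).
Proof.
move=> connG [A edgeA] [s win_s]; exists (atk_strategy A s y0 connG).
exact: atk_winning.
Qed.

Lemma cops_win_empty (G : sgraph) (atk : bool) :
  (G -> False) -> cops_win G atk 0.
Proof.
move=> noG; exists (Strategy (ffun0 (card_ord 0)) (fun=> [ffun=> None])) => r.
by case: (noG (r 0)).
Qed.

Theorem theorem9 (G : sgraph) (connG : graph_connected G) (bipG : bipartite G) :
  attacking_cop_number G <= cop_number G + 2.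
Proof.
rewrite /attacking_cop_number; case: ex_minnP => m _ min_m.
rewrite /cop_number; case: ex_minnP => k /asboolP win_k _.
(* The empty graph offers no vertex [y0] for the pair, but no play to the robber either. *)
case: (pickP (fun _ : G => true)) => [y0 _|noG].
  by apply/min_m/asboolP/cops_win_attacking.
apply: leq_trans (leq0n _); apply/min_m/asboolP/cops_win_empty => x.
by have := noG x.
Qed.
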